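(* Let $N \ge 2$ and $a$ be integers with $\gcd(a,N)=1$, and let $$X_N = \left\{ \left( \frac{n}{N}, \left\{ \frac{a n}{N}\right\} \right) : 0 \le n \le N-1 \right\} \subset \mathbb{T}^2 .$$ Write $x_n = (n/N, \{an/N\})$ for $0 \le n \le N-1$. For an index $j \in \{0,\dots,N-1\}$ and a vector $v \in \mathbb{R}^2$, let $X_N^{(j,v)}$ denote the configuration obtained from $X_N$ by replacing $x_j$ by $x_j + v$ (mod $1$ in each coordinate) and keeping all other points fixed. Let $E$ be the energy functional defined in the context (with $d=2$). Then: (1) $X_N$ is a critical point of $E$, in the sense that for every $j \in \{0,\dots,N-1\}$, $$E\big(X_N^{(j,v)}\big) - E(X_N) = O(\|v\|^2) \quad \text{as } v \to 0 .$$ (2) If moreover $a^2 \equiv 1 \pmod N$, then $X_N$ is a strict local minimum of $E$, in the sense that for every $j \in \{0,\dots,N-1\}$ there exist $c > 0$ and $\eta > 0$ such that $$E\big(X_N^{(j,v)}\big) - E(X_N) \ge c\,\|v\|^2 \quad \text{for all } v \in \mathbb{R}^2 \text{ with } \|v\| < \eta .$$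
   Context: $\mathbb{T}^d \cong [0,1]^d$ is the $d$-dimensional torus, with points represented by coordinates in $[0,1)$, and $\{x\} = x - \lfloor x \rfloor$ denotes the fractional part. For a configuration $X$ of $N$ points $x_1,\dots,x_N \in \mathbb{T}^d$, with coordinates $x_n = (x_{n,1},\dots,x_{n,d})$, the energy is $$E(X) = \sum_{\substack{1 \le m,n \le N \\ m \ne n}} \ \prod_{k=1}^{d} \Big(1 - \log\big(2 \sin(\pi |x_{m,k} - x_{n,k}|)\big)\Big),$$ with $E(X) = \infty$ if two different points share a $k$-th coordinate for some $k$. (Any indexing of the points by $N$ labels may be used.) The notions of critical point and strict local minimum are those obtained by moving one single point while all the others remain fixed, as spelled out in the claim. $\|\cdot\|$ is the Euclidean norm on $\mathbb{R}^2$, and $\log$ is the natural logarithm. *)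

(* Defs.v *)
From mathcomp Require Import all_boot all_order all_algebra.
From mathcomp Require Import all_classical all_reals all_analysis.

Set Implicit Arguments.
Unset Strict Implicit.
Unset Printing Implicit Defensive.

Import Order.TTheory GRing.Theory Num.Theory.
Local Open Scope ring_scope.

Definition frac (R : realType) (x : R) : R := x - (Num.floor x)%:~R.

(* A point of the torus is a row vector of representatives, all in [0, 1[. *)
Definition config (R : realType) (d N : nat) := 'I_N -> 'rV[R]_d.

Definition share_coord (R : realType) (d N : nat) (X : config R d N) : bool :=
  [exists m : 'I_N, exists n : 'I_N, exists k : 'I_d,
    (m != n) && (X m ord0 k == X n ord0 k)].

Definition energy (R : realType) (d N : nat) (X : config R d N) : \bar R :=
  if share_coord X then +oo%E
  else (\sum_(m < N) \sum_(n < N | m != n) \prod_(k < d)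
          (1 - ln (2 * sin (pi * `|X m ord0 k - X n ord0 k|))))%:E.

(* X with its j-th point translated by v in the torus. *)
Definition move (R : realType) (d N : nat) (X : config R d N)
    (j : 'I_N) (v : 'rV[R]_d) : config R d N :=
  fun i => if i == j then map_mx (@frac R) (X j + v) else X i.

(* The library norm on row vectors is the sup norm, hence this definition. *)
Definition enorm (R : realType) (d : nat) (v : 'rV[R]_d) : R :=
  Num.sqrt (\sum_(k < d) v ord0 k ^+ 2).

(* In \bar R, x - +oo = -oo for every x, so either property below forces
   energy X to be finite; a bound on the real difference is thus meant. *)
Definition critical_point (R : realType) (d N : nat) (X : config R d N) : Prop :=
  forall j : 'I_N, exists C eta : R, 0 < eta /\
    forall v : 'rV[R]_d, enorm v < eta ->
      (`|energy (move X j v) - energy X| <= (C * enorm v ^+ 2)%:E)%E.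

Definition strict_local_min (R : realType) (d N : nat) (X : config R d N) : Prop :=
  forall j : 'I_N, exists c eta : R, [/\ 0 < c, 0 < eta &
    forall v : 'rV[R]_d, enorm v < eta ->
      ((c * enorm v ^+ 2)%:E <= energy (move X j v) - energy X)%E].

Definition lattice (R : realType) (N : nat) (a : int) : config R 2 N :=
  fun n => \row_(k < 2)
    if k == ord0 then n%:R / N%:R else frac (a%:~R * n%:R / N%:R).
Arguments lattice : clear implicits.

(* Main.v *)
Require Import Defs.
From mathcomp Require Import all_boot all_order all_algebra.
From mathcomp Require Import all_classical all_reals all_analysis.
From mathcomp Require Import zify ring lra.

Set Implicit Arguments.
Unset Strict Implicit.
Unset Printing Implicit Defensive.

Import Order.TTheory GRing.Theory Num.Theory.
Import numFieldNormedType.Exports.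
Local Open Scope classical_set_scope.
Local Open Scope ring_scope.

(** Write phi x = 1 - log |2 sin (pi x)|, an even 1-periodic function.  Moving
    the j-th point by v changes the energy by twice the sum over m <> j of
    P_m(v) - P_m(0), where P_m(v) = phi (x + v_1) * phi (y + v_2) and (x, y) is
    the difference of the j-th and m-th points ([energy_move]).

    The reflection m |-> 2 j - m modulo N preserves the lattice and turns
    (x, y) into - (x, y) modulo 1 ([lattice_reflection]).  Since phi is even,
    the sum of the P_m(v) is an even function of v, so the first order terms
    cancel, and twice the change of the sum is the sum of the symmetric second
    differences P_m(v) + P_m(-v) - 2 P_m(0).

    For small v each second difference lies between two multiples of |v|^2,
    the lower one with a positive constant ([second_difference_bounds]).  The
    reason is that phi is strictly log-convex: its first two derivatives are
    - pi cot (pi x) and pi^2 / sin^2 (pi x), so that phi * phi'' > phi'^2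
    amounts to phi > cos^2 (pi x), which is a consequence of log t <= t - 1
    ([phi_gt_sqr_cos]).  A product of two positive strictly
    log-convex functions of separate variables has a positive definite Hessian,
    so the lattice is critical and the energy grows quadratically around it. *)

(** * The one-variable factor of the energy *)

(** The square replaces an absolute value: phi is even, 1-periodic, and
    differentiable wherever the sine does not vanish, by the rules for ln. *)
Definition phi (R : realType) (x : R) : R :=
  1 - ln ((2 * sin (pi * x)) ^+ 2) / 2.

Definition evenpart (R : realType) (f : R -> R) (x s : R) : R :=
  (f (x + s) + f (x - s)) / 2.

Definition oddpart (R : realType) (f : R -> R) (x s : R) : R :=
  (f (x + s) - f (x - s)) / 2.

Lemma phiN (R : realType) (x : R) : phi (- x) = phi x.
Proof. by rewrite /phi mulrN sinN mulrN sqrrN. Qed.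

Lemma sqr_sin_periodic (R : realType) (x : R) (k : int) :
  sin (pi * (x + k%:~R)) ^+ 2 = sin (pi * x) ^+ 2.
Proof.
have posP (y : R) (n : nat) : sin (pi * (y + n%:R)) ^+ 2 = sin (pi * y) ^+ 2.
  elim: n => [|n IHn]; first by rewrite addr0.
  rewrite -natr1 addrA mulrDr mulr1.
  have -> := @sinDpi R (pi * (y + n%:R)).
  by rewrite sqrrN.
case: k => n; first exact: posP.
by rewrite NegzE mulrNz -[in RHS](subrK (n.+1%:R) x) posP.
Qed.

Lemma phi_periodic (R : realType) (x : R) (k : int) :
  phi (x + k%:~R) = phi x.
Proof. by rewrite /phi !exprMn sqr_sin_periodic. Qed.

(** With S = sin^2 (pi x) the claim is ln (4 S) < 2 S.  It follows from
    ln (2 S) <= 2 S - 1 and ln 2 < 1. *)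
Lemma phi_gt_sqr_cos (R : realType) (x : R) :
  sin (pi * x) != 0 -> cos (pi * x) ^+ 2 < phi x.
Proof.
move=> s0; rewrite /phi cos2sin2 exprMn; set S := sin _ ^+ 2.
have S0 : 0 < S by rewrite exprn_even_gt0.
have l2 : ln 2 < 1 :> R.
  (* Splitting 2 = 4/3 * 3/2 gives ln 2 <= 1/3 + 1/2. *)
  have -> : 2 = (1 + 3^-1) * (1 + 2^-1) :> R by field.
  rewrite lnM ?posrE; [|lra|lra].
  have : ln (1 + 3^-1) <= 3^-1 :> R by apply: le_ln1Dx; lra.
  have : ln (1 + 2^-1) <= 2^-1 :> R by apply: le_ln1Dx; lra.
  lra.
have : ln (1 + (2 * S - 1)) <= 2 * S - 1 by apply: le_ln1Dx; lra.
have -> : 2 ^+ 2 * S = 2 * (1 + (2 * S - 1)) by ring.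
rewrite lnM ?posrE//; lra.
Qed.

(** The identity sin (u + w) sin (u - w) = sin^2 u - sin^2 w makes the even
    part of phi explicit. *)
Lemma evenpart_phi (R : realType) (x s : R)
    (sg := (sin (pi * s) / sin (pi * x)) ^+ 2) :
  sin (pi * x) != 0 -> sg < 1 ->
  sin (pi * (x + s)) != 0 /\
  evenpart (@phi R) x s - phi x = - ln (1 - sg) / 2.
Proof.
move=> x0 sg1; set S := sin (pi * x) in sg sg1 *.
have E : sin (pi * (x + s)) * sin (pi * (x - s)) = S ^+ 2 * (1 - sg).
  rewrite mulrDr mulrBr sinD sinB /sg.
  transitivity (S ^+ 2 * cos (pi * s) ^+ 2
                - cos (pi * x) ^+ 2 * sin (pi * s) ^+ 2).
    by rewrite -/S; ring.
  by rewrite !cos2sin2 -/S; field.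
have P : 0 < S ^+ 2 * (1 - sg) by rewrite mulr_gt0 ?exprn_even_gt0 ?subr_gt0.
have : sin (pi * (x + s)) * sin (pi * (x - s)) != 0 by rewrite E gt_eqF.
rewrite mulf_eq0 negb_or => /andP[a0 b0]; split=> //.
rewrite /evenpart /phi -/S; set a := sin _ in E a0 *; set b := sin _ in E b0 *.
have L : ln ((2 * a) ^+ 2) + ln ((2 * b) ^+ 2)
       = (ln ((2 * S) ^+ 2) + ln (1 - sg)) *+ 2.
  have sq_pos (c : R) : c != 0 -> (2 * c) ^+ 2 \is Num.pos.
    by move=> c0; rewrite posrE exprn_even_gt0//= mulf_neq0.
  rewrite -!lnM ?sq_pos ?posrE ?subr_gt0// -lnXn; last first.
    by rewrite mulr_gt0 ?subr_gt0// -posrE sq_pos.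
  congr ln; transitivity ((4 * (a * b)) ^+ 2); first by ring.
  by rewrite E; ring.
rewrite -[RHS](addrK (- phi x)); rewrite /phi -/S; lra.
Qed.

(** First-order information suffices for quadratic bounds on a square: the
    squared difference quotient of g at 0 tends to k ^+ 2. *)
Lemma sqr_slope (R : realType) (g : R -> R) (k A B : R) :
  is_derive (0 : R) (1 : R) g k -> g 0 = 0 -> A < k ^+ 2 < B ->
  \forall s \near 0, A * s ^+ 2 <= g s ^+ 2 <= B * s ^+ 2.
Proof.
move=> dg g0 /andP[Ak kB].
have [dk ek] := dg.
have : (fun h => h^-1 *: (g (h *: 1 + 0) - g 0)) @ (0 : R)^' --> k.
  rewrite -ek; exact: dk.
move=> cg.
have cg2 : (fun h => (h^-1 *: (g (h *: 1 + 0) - g 0)) ^+ 2) @ (0 : R)^'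
    --> k ^+ 2.
  exact: cvgM.
have : \forall h \near (0 : R)^', A * h ^+ 2 <= g h ^+ 2 <= B * h ^+ 2.
  near=> h.
  have h0 : h != 0 by near: h; exact: nbhs_dnbhs_neq.
  have h2 : 0 < h ^+ 2 by rewrite exprn_even_gt0.
  have q : g h ^+ 2 / h ^+ 2 = (h^-1 *: (g (h *: 1 + 0) - g 0)) ^+ 2.
    by rewrite g0 subr0 addr0 /GRing.scale/= mulr1; field.
  apply/andP; split.
    rewrite -ler_pdivlMr// q.
    by near: h; exact: cvgr_ge cg2 _ Ak.
  rewrite -ler_pdivrMr// q.
  by near: h; exact: cvgr_le cg2 _ kB.
rewrite near_withinE; apply: filterS => h hP.
have [->|h0] := eqVneq h 0; last exact: hP.
by rewrite g0 expr0n /= !mulr0 lexx.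
Unshelve. all: by end_near. Qed.
Lemma is_derive_phi (R : realType) (x : R) : sin (pi * x) != 0 ->
  is_derive x (1 : R) (@phi R) (- (pi * cos (pi * x) / sin (pi * x))).
Proof.
move=> s0.
have s2 : 0 < (2 * sin (pi * x)) ^+ 2.
  by rewrite exprn_even_gt0//= mulf_neq0.
have dsin : is_derive x (1 : R) (fun y => sin (pi * y)) (pi * cos (pi * x)).
  have d : is_derive x (1 : R) (fun y : R => pi * y) pi.
    have := is_deriveZ pi (is_derive_id x (1 : R)).
    by rewrite /GRing.scale/= mulr1.
  rewrite mulrC.
  exact: (@is_derive1_comp _ (@sin R) (fun y : R => pi * y)
            _ _ _ (is_derive_sin _) d).
have dsq : is_derive x (1 : R) (fun y => (2 * sin (pi * y)) ^+ 2)
    (8 * sin (pi * x) * (pi * cos (pi * x))).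
  have -> : (fun y : R => (2 * sin (pi * y)) ^+ 2) =
            4 \*: ((fun y => sin (pi * y)) * (fun y => sin (pi * y))).
    apply/funext => y /=; rewrite mulrfctE /GRing.scale/=; ring.
  by apply: is_derive_eq; rewrite /GRing.scale/=; ring.
have dln : is_derive x (1 : R) (fun y => ln ((2 * sin (pi * y)) ^+ 2))
   (((2 * sin (pi * x)) ^+ 2)^-1 * (8 * sin (pi * x) * (pi * cos (pi * x)))).
  have := is_derive1_ln s2.
  move=> dl.
  exact: (@is_derive1_comp _ (@ln R) (fun y : R => (2 * sin (pi * y)) ^+ 2)
            _ _ _ dl dsq).
have -> : @phi R = cst 1 - 2^-1 \*: (fun y => ln ((2 * sin (pi * y)) ^+ 2)).
  by apply/funext => y /=; rewrite /phi /GRing.scale/= mulrC.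
by apply: is_derive_eq; rewrite /GRing.scale/=; field.
Qed.

Lemma is_derive_oddpart (R : realType) (f : R -> R) (x k : R) :
  is_derive x (1 : R) f k -> is_derive (0 : R) (1 : R) (oddpart f x) k.
Proof.
move=> df.
have dr : is_derive (0 : R) (1 : R) (fun s : R => x + s) 1.
  have := is_deriveD (is_derive_cst x (0 : R) (1 : R))
                     (is_derive_id (0 : R) (1 : R)).
  by rewrite add0r.
have dl : is_derive (0 : R) (1 : R) (fun s : R => x - s) (- 1).
  have := is_deriveB (is_derive_cst x (0 : R) (1 : R))
                     (is_derive_id (0 : R) (1 : R)).
  by rewrite sub0r.
have dfr : is_derive (x + 0) (1 : R) f k by rewrite addr0.
have dfl : is_derive (x - 0) (1 : R) f k by rewrite subr0.
have dr' := @is_derive1_comp R f (fun s => x + s) 0 _ _ dfr dr.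
have dl' := @is_derive1_comp R f (fun s => x - s) 0 _ _ dfl dl.
have -> : oddpart f x =
    2^-1 \*: ((f \o (fun s => x + s)) - (f \o (fun s => x - s))).
  by apply/funext => s /=; rewrite /oddpart /GRing.scale/= mulrC.
by apply: is_derive_eq; rewrite /GRing.scale/=; field.
Qed.

(** Strict log-convexity of phi at x, in finite-difference form.  Let u be the
    increment of the even part, d the odd part and p = phi x.  To leading order
    u is pi^2 s^2 / (2 sin^2 (pi x)) and d^2 is pi^2 cot^2 (pi x) s^2, so
    2 p u - d^2 is positive of order s^2 exactly when p > cos^2 (pi x). *)
Lemma phi_log_convex (R : realType) (x : R) : sin (pi * x) != 0 ->
  exists c C : R, [/\ 0 < c, 0 <= C & \forall s \near 0,
    [/\ sin (pi * (x + s)) != 0,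
        0 <= evenpart (@phi R) x s - phi x <= C * s ^+ 2 &
        c * s ^+ 2 <= 2 * phi x * (evenpart (@phi R) x s - phi x)
                      - oddpart (@phi R) x s ^+ 2]].
Proof.
move=> x0; have p_cos := phi_gt_sqr_cos x0.
have p0 : 0 < phi x by apply: le_lt_trans p_cos; exact: sqr_ge0.
set p := phi x in p_cos p0 *; set S := sin (pi * x) in x0.
pose T := (pi / S) ^+ 2; pose K := (- (pi * cos (pi * x) / S)) ^+ 2.
have T0 : 0 < T by rewrite exprn_even_gt0//= mulf_neq0 ?invr_neq0// gt_eqF ?pi_gt0.
have KpT : K < p * T.
  have -> : K = cos (pi * x) ^+ 2 * T by rewrite /K /T; ring.
  by rewrite ltr_pM2r.
(* The squared odd part is at most B s^2 for any B > K, and sg below is at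
   least A s^2 for any A < T; since K < p T, midpoints leave room for
   B < p A. *)
pose B := (K + p * T) / 2; pose A := (B / p + T) / 2.
have pA : p * A = (B + p * T) / 2 by rewrite /A; field; rewrite gt_eqF.
have AT : A < T.
  by rewrite -(ltr_pM2l p0) pA /B; lra.
exists (p * A - B), (T + 1); split; [rewrite pA /B; lra | lra |].
have dd := is_derive_oddpart (is_derive_phi x0).
have d0 : oddpart (@phi R) x 0 = 0 by rewrite /oddpart addr0 subr0 subrr mul0r.
have ds : is_derive (0 : R) (1 : R) (fun s : R => sin (pi * s) / S) (pi / S).
  have d : is_derive (0 : R) (1 : R) (fun y : R => pi * y) pi.
    have := is_deriveZ pi (is_derive_id (0 : R) (1 : R)).
    by rewrite /GRing.scale/= mulr1.
  have dsin0 : is_derive (pi * 0 : R) (1 : R) sin 1.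
    by have := is_derive_sin (pi * 0 : R); rewrite mulr0 cos0.
  have d' := @is_derive1_comp _ (@sin R) (fun y : R => pi * y) _ _ _ dsin0 d.
  have -> : (fun s : R => sin (pi * s) / S) =
      S^-1 \*: (sin \o (fun y : R => pi * y)).
    by apply/funext => s /=; rewrite /GRing.scale/= mulrC.
  by apply: is_derive_eq; rewrite /GRing.scale/=; ring.
have s0 : sin (pi * 0) / S = 0 by rewrite mulr0 sin0 mul0r.
have nT : \forall s \near (0 : R), `|s| <= (2 * (T + 1))^-1.
  have e0 : 0 < (2 * (T + 1))^-1 by rewrite invr_gt0; lra.
  exact: (@nbhs0_le R R _ e0).
near=> s.
(* Only the upper bound matters here, so any lower constant below K will do. *)
have /andP[_ oddB] : (K - 1) * s ^+ 2 <= oddpart (@phi R) x s ^+ 2 <= B * s ^+ 2.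
  near: s; apply: sqr_slope dd d0 _.
  by apply/andP; split; rewrite -/K /B; lra.
have /andP[sgA sgT] : A * s ^+ 2 <= (sin (pi * s) / S) ^+ 2 <= (T + 1) * s ^+ 2.
  near: s; apply: (sqr_slope ds s0).
  by apply/andP; split; rewrite -/T; lra.
set sg := (sin (pi * s) / S) ^+ 2 in sgA sgT.
have sg2 : sg <= 2^-1.
  apply: le_trans sgT _.
  have sT : `|s| <= (2 * (T + 1))^-1.
    by near: s; exact: nT.
  have s1 : `|s| <= 1 by apply: le_trans sT _; rewrite invf_le1; lra.
  have : (T + 1) * `|s| ^+ 2 <= (T + 1) * (2 * (T + 1))^-1.
    rewrite ler_pM2l; last lra.
    by have := normr_ge0 s; nra.
  rewrite real_normK ?num_real//; move/le_trans; apply.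
  by rewrite invfM mulrCA mulfV ?mulr1 ?gt_eqF//; lra.
have sg0 : 0 <= sg by exact: sqr_ge0.
have sg1 : sg < 1 by lra.
have [sr uE] := evenpart_phi x0 sg1.
rewrite uE -/S -/sg.
have L1 : ln (1 - sg) <= - sg by apply: le_ln1Dx; lra.
have L2 : - ln (1 - sg) <= 2 * sg.
  rewrite -lnV ?posrE; last lra.
  have : ln (1 + ((1 - sg)^-1 - 1)) <= (1 - sg)^-1 - 1.
    by apply: le_ln1Dx; rewrite -subr_gt0 opprK subrK invr_gt0; lra.
  rewrite addrCA subrr addr0 => /le_trans; apply.
  rewrite lerBlDr -[_^-1]mul1r ler_pdivrMr; nra.
split => //; first by apply/andP; split; lra.
nra.
Unshelve. all: by end_near. Qed.

(** * Two variables *)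

(** For u, w the increments of the even parts, d, f the odd parts, p = phi x
    and q = phi y, half of the second difference is (p + u)(q + w) + d f - p q.
    Multiplied by 2 p q it dominates q^2 (2 p u) + p^2 (2 q w) + 2 (q d)(p f),
    and log-convexity of each factor bounds this below by (q d + p f)^2 plus a
    positive definite form in (s, t). *)
Lemma second_difference_bounds (R : realType) (x y : R) :
  sin (pi * x) != 0 -> sin (pi * y) != 0 ->
  exists c C e : R, [/\ 0 < c, 0 < e & forall s t : R, `|s| < e -> `|t| < e ->
    [/\ sin (pi * (x + s)) != 0, sin (pi * (y + t)) != 0 &
     c * (s ^+ 2 + t ^+ 2)
       <= phi (x + s) * phi (y + t) + phi (x - s) * phi (y - t)
          - 2 * (phi x * phi y)
       <= C * (s ^+ 2 + t ^+ 2)]].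
Proof.
move=> x0 y0.
have p0 : 0 < phi x := le_lt_trans (sqr_ge0 _) (phi_gt_sqr_cos x0).
have q0 : 0 < phi y := le_lt_trans (sqr_ge0 _) (phi_gt_sqr_cos y0).
have [cx [Cx [cx0 Cx0 /nbhs_norm0P[ex/= ex0 Hx]]]] := phi_log_convex x0.
have [cy [Cy [cy0 Cy0 /nbhs_norm0P[ey/= ey0 Hy]]]] := phi_log_convex y0.
set p := phi x in p0 Hx *; set q := phi y in q0 Hy *.
exists (Num.min (cx * q / p) (cy * p / q)).
exists (2 * (Cx * (q + Cy) + p * Cy + p * Cx + q * Cy)).
exists (Num.min 1 (Num.min ex ey)); split.
- by rewrite lt_min !divr_gt0 ?mulr_gt0.
- by rewrite !lt_min ltr01 ex0.
move=> s t; rewrite !lt_min => /and3P[_ sx _] /and3P[t1 _ ty].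
have [xs /andP[ux0 uxC] dx] := Hx s sx.
have [yt /andP[uy0 uyC] dy] := Hy t ty.
split => //.
have -> : phi (x + s) * phi (y + t) + phi (x - s) * phi (y - t)
  = 2 * (evenpart (@phi R) x s * evenpart (@phi R) y t
         + oddpart (@phi R) x s * oddpart (@phi R) y t).
  by rewrite /evenpart /oddpart; field.
move: dx dy ux0 uxC uy0 uyC.
rewrite -[evenpart _ x s](subrK p) -[evenpart _ y t](subrK q) !addrK.
move: (evenpart _ x s - p) (evenpart _ y t - q) (oddpart _ x s) (oddpart _ y t).
move=> u w d f dx dy u0 uC w0 wC.
have t2 : t ^+ 2 <= 1
  by rewrite -real_normK ?num_real//; have := normr_ge0 t; nra.
have s20 := sqr_ge0 s; have t20 := sqr_ge0 t.
have d20 := sqr_ge0 d; have f20 := sqr_ge0 f.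
apply/andP; split.
  have H : cx * q ^+ 2 * s ^+ 2 + cy * p ^+ 2 * t ^+ 2
      <= p * q * (2 * ((u + p) * (w + q) + d * f) - 2 * (p * q)).
    have -> : p * q * (2 * ((u + p) * (w + q) + d * f) - 2 * (p * q)) =
       q ^+ 2 * (2 * p * u - d ^+ 2) + p ^+ 2 * (2 * q * w - f ^+ 2)
       + (q * d + p * f) ^+ 2 + 2 * (p * q) * (u * w) by ring.
    have h1 := ler_wpM2l (sqr_ge0 q) dx.
    have h2 := ler_wpM2l (sqr_ge0 p) dy.
    have h3 := sqr_ge0 (q * d + p * f).
    have h4 : 0 <= 2 * (p * q) * (u * w) by rewrite !mulr_ge0// ltW.
    lra.
  rewrite -(ler_pM2l (mulr_gt0 p0 q0)); apply: le_trans H.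
  set c := Num.min _ _.
  have cx' : c * p <= cx * q by rewrite -ler_pdivlMr// /c ge_min lexx.
  have cy' : c * q <= cy * p by rewrite -ler_pdivlMr// /c ge_min lexx orbT.
  have h1 := ler_wpM2r s20 (ler_wpM2l (ltW q0) cx').
  have h2 := ler_wpM2r t20 (ler_wpM2l (ltW p0) cy').
  lra.
have uw : u * w <= Cx * s ^+ 2 * (Cy * 1).
  by apply: ler_pM => //; apply: le_trans wC _; rewrite ler_wpM2l.
have qu := ler_wpM2l (ltW q0) uC; have pu := ler_wpM2l (ltW p0) uC.
have qw := ler_wpM2l (ltW q0) wC; have pw := ler_wpM2l (ltW p0) wC.
have df := sqr_ge0 (d - f).
have k1 : 0 <= Cx * t ^+ 2 * (q + Cy + p).
  by apply: (mulr_ge0 (mulr_ge0 Cx0 t20)); lra.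
have k2 : 0 <= Cy * s ^+ 2 * (q + p).
  by apply: (mulr_ge0 (mulr_ge0 Cy0 s20)); lra.
nra.
Qed.

(** * The change of energy when one point moves *)

Lemma sum_pairs_diff (R : realType) (N : nat) (j : 'I_N)
    (T T' : 'I_N -> 'I_N -> R) :
  (forall m n, T m n = T n m) -> (forall m n, T' m n = T' n m) ->
  (forall m n, m != j -> n != j -> T' m n = T m n) ->
  \sum_(m < N) \sum_(n < N | m != n) T' m n
  - \sum_(m < N) \sum_(n < N | m != n) T m n
  = 2 * \sum_(m < N | m != j) (T' j m - T j m).
Proof.
move=> Tsym T'sym TT'.
rewrite -sumrB.
rewrite (eq_bigr (fun m => \sum_(n < N | m != n) (T' m n - T m n))); last first.
  by move=> m _; rewrite sumrB.
rewrite (bigD1 j)//= mulr_natl mulr2n; congr (_ + _).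
  by apply: eq_bigl => m; rewrite eq_sym.
apply: eq_bigr => m mj; rewrite (bigD1 j)//= big1 ?addr0.
  by rewrite Tsym T'sym.
by move=> n /andP[_ nj]; rewrite TT'// subrr.
Qed.

Lemma frac_bounds (R : realType) (x : R) : 0 <= Defs.frac x < 1.
Proof.
have := real_floor_itv (num_real x); rewrite intrD1 /Defs.frac => /andP[h1 h2].
by apply/andP; split; lra.
Qed.

Lemma sin_eq0_int (R : realType) (x : R) :
  sin (pi * x) = 0 -> exists z : int, x = z%:~R.
Proof.
move=> sx; exists (Num.floor x); have [f0|f0] := eqVneq (Defs.frac x) 0.
  by apply/eqP; rewrite -subr_eq0 -[_ - _]/(Defs.frac x) f0.
have : sin (pi * Defs.frac x) ^+ 2 = 0.
  by rewrite /Defs.frac -mulrNz sqr_sin_periodic sx expr0n.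
have /andP[fge0 flt1] := frac_bounds x.
have fgt0 : 0 < Defs.frac x by rewrite lt_def f0.
move/eqP; rewrite sqrf_eq0 gt_eqF// sin_gt0_pi//.
by rewrite mulr_gt0 ?pi_gt0//= gtr_pMr ?pi_gt0.
Qed.

Lemma phi_unit_dist (R : realType) (x y : R) :
  0 <= x < 1 -> 0 <= y < 1 -> sin (pi * (x - y)) != 0 ->
  1 - ln (2 * sin (pi * `|x - y|)) = phi (x - y).
Proof.
move=> /andP[x0 x1] /andP[y0 y1] s0.
have -> : phi (x - y) = phi `|x - y|.
  by case: (leP 0 (x - y)) => [/ger0_norm|/ltr0_norm] ->; rewrite ?phiN.
have xy : x != y by apply: contraNneq s0 => ->; rewrite subrr mulr0 sin0.
have d0 : 0 < `|x - y| by rewrite normr_gt0 subr_eq0.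
have d1 : `|x - y| < 1 by rewrite ltr_norml; lra.
rewrite /phi lnXn; first by rewrite -[ln _ *+ 2]mulr_natr mulfK.
by rewrite mulr_gt0// sin_gt0_pi// mulr_gt0 ?pi_gt0//= gtr_pMr ?pi_gt0.
Qed.

Lemma energyE (R : realType) (d N : nat) (X : config R d N) :
  (forall m k, 0 <= X m ord0 k < 1) ->
  (forall m n k, m != n -> sin (pi * (X m ord0 k - X n ord0 k)) != 0) ->
  energy X = (\sum_(m < N) \sum_(n < N | m != n)
                 \prod_(k < d) phi (X m ord0 k - X n ord0 k))%:E.
Proof.
move=> X01 Xs; rewrite /energy ifF.
  congr EFin; apply: eq_bigr => m _; apply: eq_bigr => n mn.
  by apply: eq_bigr => k _; rewrite phi_unit_dist// Xs.
apply/negbTE/existsPn => m; apply/existsPn => n; apply/existsPn => k.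
apply/negP => /andP[mn /eqP E].
by have := Xs m n k mn; rewrite E subrr mulr0 sin0 eqxx.
Qed.

Lemma sin_neq0_congr (R : realType) (x y : R) (z : int) :
  x = y + z%:~R -> (sin (pi * x) != 0) = (sin (pi * y) != 0).
Proof. by move=> ->; rewrite -sqrf_eq0 sqr_sin_periodic sqrf_eq0. Qed.

(** The coordinates of a moved point differ from those of X j + v by integers,
    which phi does not see; the last hypothesis keeps the moved configuration
    at finite energy. *)
Lemma energy_move (R : realType) (d N : nat) (X : config R d N) (j : 'I_N)
    (v : 'rV[R]_d) :
  (forall m k, 0 <= X m ord0 k < 1) ->
  (forall m n k, m != n -> sin (pi * (X m ord0 k - X n ord0 k)) != 0) ->
  (forall m k, m != j -> sin (pi * (X j ord0 k - X m ord0 k + v ord0 k)) != 0) ->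
  (energy (move X j v) - energy X =
   (2 * \sum_(m < N | m != j)
      (\prod_(k < d) phi (X j ord0 k - X m ord0 k + v ord0 k)
       - \prod_(k < d) phi (X j ord0 k - X m ord0 k)))%:E)%E.
Proof.
move=> X01 Xs Xv.
have moveE m k : m != j -> move X j v j ord0 k - move X j v m ord0 k =
    X j ord0 k - X m ord0 k + v ord0 k
    + (- Num.floor (X j ord0 k + v ord0 k))%:~R.
  by move=> mj; rewrite /move eqxx (negPf mj) !mxE /Defs.frac mulrNz; ring.
have move_off m k : m != j -> move X j v m ord0 k = X m ord0 k.
  by move=> mj; rewrite /move (negPf mj).
have sinC (x y : R) : (sin (pi * (x - y)) != 0) = (sin (pi * (y - x)) != 0).
  by rewrite -opprB mulrN sinN oppr_eq0.
have prodC (Y : config R d N) m n :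
    \prod_(k < d) phi (Y m ord0 k - Y n ord0 k) =
    \prod_(k < d) phi (Y n ord0 k - Y m ord0 k).
  by apply: eq_bigr => k _; rewrite -phiN opprB.
rewrite !energyE//.
- rewrite -EFinB (sum_pairs_diff (j := j)) //; first last.
  + by move=> m n mj nj; apply: eq_bigr => k _; rewrite !move_off.
  congr (_ * _)%:E; apply: eq_bigr => m mj; congr (_ - _).
  by apply: eq_bigr => k _; rewrite moveE// phi_periodic.
- move=> m k; have [->|mj] := eqVneq m j; last by rewrite move_off.
  by rewrite /move eqxx !mxE frac_bounds.
- move=> m n k mn; have [mj|mj] := eqVneq m j.
    rewrite mj in mn *; have nj : n != j by rewrite eq_sym.
    by rewrite (sin_neq0_congr (moveE n k nj)) Xv.
  have [->|nj] := eqVneq n j; last by rewrite !move_off// Xs.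
  by rewrite sinC (sin_neq0_congr (moveE m k mj)) Xv.
Qed.

(** * The lattice *)

(** Both coordinates of the lattice have the form slope * n / N modulo 1 with
    a slope prime to N, and can thus be treated alike. *)
Definition slope (a : int) (k : 'I_2) : int := if k == ord0 then 1 else a.

Lemma lattice_coord (R : realType) (N : nat) (a : int) (n : 'I_N) (k : 'I_2) :
  exists z : int,
    lattice R N a n ord0 k = (slope a k)%:~R * n%:R / N%:R + z%:~R.
Proof.
rewrite mxE /slope; case: ifP => _; first by exists 0; rewrite mul1r addr0.
by eexists; rewrite /Defs.frac -mulrNz.
Qed.

Lemma lattice_bounds (R : realType) (N : nat) (a : int) (n : 'I_N) (k : 'I_2) :
  0 <= lattice R N a n ord0 k < 1.
Proof.
rewrite mxE; case: ifP => _; last exact: frac_bounds.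
have N0 : (0 : R) < N%:R by rewrite ltr0n; case: N n => // -[].
by rewrite divr_ge0 ?ler0n//= ltr_pdivrMr// mul1r ltr_nat.
Qed.

(** If the sine vanishes, N divides slope * (m - n), hence m - n. *)
Lemma lattice_diff_nondegenerate (R : realType) (N : nat) (a : int)
    (m n : 'I_N) (k : 'I_2) :
  gcdz a N%:Z = 1 -> m != n ->
  sin (pi * (lattice R N a m ord0 k - lattice R N a n ord0 k)) != 0.
Proof.
move=> aN; apply: contra => /eqP/sin_eq0_int[z].
have [zm ->] := lattice_coord R a m k; have [zn ->] := lattice_coord R a n k.
have N0 : (N%:R : R) != 0 by rewrite pnatr_eq0; case: N m {n zn zm aN} => // -[].
move=> E.
have {}E : slope a k * (m%:Z - n%:Z) = (z - zm + zn) * N%:Z.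
  apply: (@intr_inj R); rewrite !(intrM, intrD, mulrNz).
  by rewrite -E -!pmulrn; field.
have cN : coprimez N%:Z (slope a k).
  rewrite /slope; case: ifP => _; first by rewrite coprimezE coprimen1.
  by rewrite coprimez_sym /coprimez aN.
have : (N%:Z %| m%:Z - n%:Z)%Z.
  by rewrite -(Gauss_dvdzr _ cN) E dvdz_mull.
rewrite -eqz_mod_dvd !modz_nat !modn_small// => /eqP[mn]; exact/eqP/val_inj.
Qed.

(** The reflection is m |-> j + j - m in the group of integers modulo N. *)
Lemma lattice_reflection (R : realType) (N : nat) (a : int) (j : 'I_N) :
  exists r : 'I_N -> 'I_N, [/\ involutive r, r j = j &
    forall m k, exists z : int,
      lattice R N a j ord0 k - lattice R N a (r m) ord0 k =
      - (lattice R N a j ord0 k - lattice R N a m ord0 k) + z%:~R].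
Proof.
case: N j => [[]//|N] j.
exists (fun m => j + j - m); split; [by move=> m; rewrite subKr | by rewrite addrK |].
move=> m k; pose rm : 'I_N.+1 := j + j - m; rewrite -/rm.
have [w rE] : exists w : int,
    rm%:Z = j%:Z + j%:Z - m%:Z + w * N.+1%:Z.
  have jj := divn_eq (j + j) N.+1; have nm := divn_eq (N.+1 - m) N.+1.
  have jm := divn_eq ((j + j) %% N.+1 + (N.+1 - m) %% N.+1) N.+1.
  have mN := ltn_ord m.
  exists (1 - ((j + j) %/ N.+1)%N%:Z - ((N.+1 - m) %/ N.+1)%N%:Z
            - (((j + j) %% N.+1 + (N.+1 - m) %% N.+1) %/ N.+1)%N%:Z).
  have -> : nat_of_ord rm =
      (((j + j) %% N.+1 + (N.+1 - m) %% N.+1) %% N.+1)%N by [].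
  lia.
have [zm ->] := lattice_coord R a m k; have [zj ->] := lattice_coord R a j k.
have [zr ->] := lattice_coord R a rm k.
exists (zj - zr + zj - zm - slope a k * w).
have -> : (rm%:R : R) = j%:R + j%:R - m%:R + w%:~R * N.+1%:R.
  by rewrite !pmulrn rE !(intrM, intrD, mulrNz).
rewrite !(intrM, intrD, mulrNz); field.
by rewrite nat1r pnatr_eq0.
Qed.

Lemma enorm_sqr (R : realType) (v : 'rV[R]_2) :
  enorm v ^+ 2 = v ord0 ord0 ^+ 2 + v ord0 (lift ord0 ord0) ^+ 2.
Proof.
by rewrite sqr_sqrtr ?sumr_ge0// => [|k _]; rewrite ?sqr_ge0// big_ord_recl big_ord1.
Qed.

Lemma coord_le_enorm (R : realType) (d : nat) (v : 'rV[R]_d) (k : 'I_d) :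
  `|v ord0 k| <= enorm v.
Proof.
rewrite -sqrtr_sqr ler_wsqrtr// (bigD1 k)//= lerDl sumr_ge0// => i _.
exact: sqr_ge0.
Qed.

(** The bounds for the single second differences add up, with a radius small
    enough for all m at once.  The constants c and C bound the sum of second
    differences, which is exactly the change of energy: the factor 2 counting
    ordered pairs cancels the one half coming from symmetrization. *)
Lemma lattice_energy_quadratic (R : realType) (N : nat) (a : int) (j : 'I_N) :
  (2 <= N)%N -> gcdz a N%:Z = 1 ->
  exists c C eta : R, [/\ 0 < c, 0 < eta & forall v : 'rV[R]_2, enorm v < eta ->
    exists D : R,
      (energy (move (lattice R N a) j v) - energy (lattice R N a) = D%:E)%E /\
      c * enorm v ^+ 2 <= D <= C * enorm v ^+ 2].
Proof.
move=> N2 aN; set X := lattice R N a; pose k1 : 'I_2 := lift ord0 ord0.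
pose delta m k := X j ord0 k - X m ord0 k.
have Xs m n k : m != n -> sin (pi * (X m ord0 k - X n ord0 k)) != 0.
  exact: lattice_diff_nondegenerate.
have /choice[w wP] : forall m : 'I_N, exists w : R * R * R,
    [/\ 0 < w.1.1, 0 < w.2 & m != j -> forall s t : R, `|s| < w.2 -> `|t| < w.2 ->
    [/\ sin (pi * (delta m ord0 + s)) != 0, sin (pi * (delta m k1 + t)) != 0 &
     w.1.1 * (s ^+ 2 + t ^+ 2)
       <= phi (delta m ord0 + s) * phi (delta m k1 + t)
          + phi (delta m ord0 - s) * phi (delta m k1 - t)
          - 2 * (phi (delta m ord0) * phi (delta m k1))
       <= w.1.2 * (s ^+ 2 + t ^+ 2)]].
  (* For m = j any positive values do. *)
  move=> m; have [->|mj] := eqVneq m j; first by exists (1, 1, 1).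
  have jm : j != m by rewrite eq_sym.
  have [c [C [e [c0 e0 H]]]] :=
    second_difference_bounds (Xs _ _ ord0 jm) (Xs _ _ k1 jm).
  by exists (c, C, e).
have [m0 m0j] : exists m0, m0 != j.
  have [j0|j0] := eqVneq j (Ordinal (ltnW N2)); last first.
    by exists (Ordinal (ltnW N2)); rewrite eq_sym.
  by exists (Ordinal N2); rewrite j0.
exists (\sum_(m < N | m != j) (w m).1.1), (\sum_(m < N | m != j) (w m).1.2).
exists (\big[Num.min/1]_(m < N) (w m).2); split.
- rewrite (bigD1 m0)//= ltr_pwDl ?sumr_ge0//; first by have [] := wP m0.
  by move=> m _; have [/ltW] := wP m.
- by apply: lt_bigmin => // m _; have [] := wP m.
move=> v vsmall.
have vk m k : `|v ord0 k| < (w m).2.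
  apply: le_lt_trans (coord_le_enorm v k) (lt_le_trans vsmall _).
  exact: bigmin_le.
have prod2 (F : 'I_2 -> R) : \prod_(k < 2) F k = F ord0 * F k1.
  by rewrite big_ord_recl big_ord1.
pose P (u : 'rV[R]_2) m := \prod_(k < 2) phi (delta m k + u ord0 k).
have reflect_sum : \sum_(m < N | m != j) P v m = \sum_(m < N | m != j) P (- v) m.
  have [r [rK rj rE]] := lattice_reflection R a j.
  rewrite (reindex_inj (inv_inj rK))/=; apply: eq_big => [m|m _].
    by rewrite -[m == j](inj_eq (inv_inj rK)) rj.
  apply: eq_bigr => k _; rewrite /delta [(- v) _ _]mxE; have [z] := rE m k; rewrite -/X => ->.
  by rewrite addrAC phi_periodic -phiN opprD opprK.
pose P0 m := \prod_(k < 2) phi (delta m k).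
exists (\sum_(m < N | m != j) (P v m + P (- v) m - 2 * P0 m)); split.
  rewrite energy_move//; last 2 first.
  - by move=> m k; exact: lattice_bounds.
  - move=> m k mj; have [_ _ /(_ mj _ _ (vk m ord0) (vk m k1))[s0 s1 _]] := wP m.
    by case: (unliftP ord0 k) => [i ->|->] //; rewrite (ord1 i).
  congr EFin; rewrite !sumrB big_split/= -reflect_sum -mulr_sumr -/(P v) -/P0.
  ring.
rewrite enorm_sqr !mulr_suml; apply/andP; split; apply: ler_sum => m mj.
  have [_ _ /(_ mj _ _ (vk m ord0) (vk m k1))[_ _ /andP[+ _]]] := wP m.
  by rewrite /P /P0 !prod2 ![(- v) _ _]mxE.
have [_ _ /(_ mj _ _ (vk m ord0) (vk m k1))[_ _ /andP[_ +]]] := wP m.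
by rewrite /P /P0 !prod2 ![(- v) _ _]mxE.
Qed.

Theorem mainTheorem1 (R : realType) (N : nat) (a : int)
    (hN : (2 <= N)%N) (haN : gcdz a N%:Z = 1) :
  critical_point (lattice R N a) /\
  ((a ^+ 2 = 1 %[mod N%:Z])%Z -> strict_local_min (lattice R N a)).
Proof.
split=> [j|_ j]; have [c [C [eta [c0 eta0 H]]]] := lattice_energy_quadratic R j hN haN.
  exists C, eta; split=> // v /H[D [-> /andP[cD DC]]].
  rewrite /= lee_fin ger0_norm//; apply: le_trans cD.
  by rewrite mulr_ge0 ?sqr_ge0// ltW.
exists c, eta; split=> // v /H[D [-> /andP[cD _]]].
by rewrite lee_fin.
Qed.
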